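(* Let $R$ be a Dedekind domain, $P=[1]=\{0<1\}$ and $n\ge0$. For any perversity $\bar p$ on $[1]$, the perverse Eilenberg–MacLane space $\mathtt K(R,n,[1],\bar p)$ is a projective cone over the classical Eilenberg–MacLane space $K(R,n)$; that is, its base is $K(R,n)$ and its cobase is a point $\Delta[0]$.
   Context: **Cylinders.** $N([1])=\Delta[1]$, and $\mathrm{Sset}_{[1]}$ is the category of simplicial maps $\Psi_K\colon K\to\Delta[1]$ (simplicial cylinders), equivalently of presheaves on the category $\Delta[[1]]$ of simplices of $\Delta[1]$. The cobase $K(0)$ and base $K(1)$ of $\Psi_K$ are the preimages (pullbacks) of the vertices $0$ and $1$ of $\Delta[1]$. A cylinder with base $B$ and cobase a point is called a projective cone over $B$. **Perversities.** A perversity on $[1]$ is given by its value $\bar p(0)\in\mathbb Z\cup\{\pm\infty\}$; $\bar p(1)=0$. **Blown-up cochains.** $N^*(-)$ denotes normalized simplicial cochains with coefficients in $R$. A simplex of $N([1])$ is $\Delta[a]*\Delta[b]$ with $a,b\ge-1$ not both $-1$ ($a+1$ vertices over $0$, $b+1$ vertices over $1$; $-1$ means empty). It is regular if $b\ge0$. Let $c\Delta[a]$ be the cone with apex $v$ as last vertex, $c\emptyset=\{v\}$. For regular simplices set $\widetilde N^*(\Delta[a]*\Delta[b])=N^*(c\Delta[a])\otimes N^*(\Delta[b])$ (equal to $N^*(\Delta[b])$ if $a=-1$), with basis $\mathbf 1_{(F_0,\varepsilon)}\otimes\mathbf 1_{F_1}$, where $(F_0,0)$ is a non-empty face $F_0$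 of $\Delta[a]$ and $(F_0,1)$ is $cF_0$ with $F_0$ a possibly empty face. The perverse degree along $0$ of such a basis element is $\dim F_1$ if $\varepsilon=0$ and $-\infty$ if $\varepsilon=1$; of a linear combination, the maximum over the terms with non-zero coefficient ($-\infty$ for $0$). $\widetilde N^*_{\bar p}(\Delta[a]*\Delta[b])$ consists of the $\omega$ such that $\omega$ and $\delta\omega$ have perverse degree $\le\bar p(0)$. Put $\widetilde N^*_{\bar p}=0$ on non-regular simplices. With restriction along maps of simplices over $\Delta[1]$ (for a simplex with no vertex over $0$, via the restriction $N^*(c\Delta[a])\to N^*(\{v\})=R$), this is a presheaf on the simplices of $\Delta[1]$. **Eilenberg–MacLane spaces.** $\mathtt K(R,n,[1],\bar p)\in\mathrm{Sset}_{[1]}$ is the presheaf $\sigma\mapsto\mathcal Z^n\widetilde N^*_{\bar p}(\sigma)$ (degree $n$ cocycles). The classical $K(R,n)$ is the simplicial set with $k$-simplices $\mathcal Z^nN^*(\Delta[k];R)$. *)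

(* Defs.v *)
From HB Require Import structures.
From mathcomp Require Import all_boot all_order all_algebra.
From mathcomp Require Import constructive_ereal.

Set Implicit Arguments.
Unset Strict Implicit.
Unset Printing Implicit Defensive.

Import Order.TTheory GRing.Theory Num.Theory.
Local Open Scope ring_scope.

(* In ring_quotient, [idealr_closed I] says that I is a proper ideal.  The unit
   ideal is generated by 1, so the Noetherian condition may ignore it. *)
Definition noetherian (R : idomainType) : Prop :=
  forall I : {pred R}, idealr_closed I ->
    exists s : seq R, forall x : R,
      x \in I <-> exists a : seq R, x = \sum_(i < size s) a`_i * s`_i.

Definition integrally_closed (R : idomainType) : Prop :=
  forall x : {fraction R},
    integralOver (@tofrac R) x -> exists a : R, x = tofrac a.

Definition nonzero_primes_maximal (R : idomainType) : Prop :=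
  forall I : {pred R}, idealr_closed I -> prime_idealr_closed I ->
    (exists2 x, x \in I & x != 0) ->
    forall J : {pred R}, idealr_closed J -> {subset I <= J} -> {subset J <= I}.

(* Fields are allowed. *)
Definition dedekind_domain (R : idomainType) : Prop :=
  [/\ noetherian R, integrally_closed R & nonzero_primes_maximal R].

(* the maps [m] -> [n] of the simplex category *)
Record ordmap (m n : nat) := OrdMap {
  ordmap_fun :> {ffun 'I_m.+1 -> 'I_n.+1};
  _ : [forall i : 'I_m.+1, forall j : 'I_m.+1,
        (i <= j)%N ==> (ordmap_fun i <= ordmap_fun j)%N] }.

HB.instance Definition _ m n := [isSub for @ordmap_fun m n].
HB.instance Definition _ m n := [Equality of ordmap m n by <:].

Lemma ordmap_homo m n (f : ordmap m n) (i j : 'I_m.+1) : (i <= j)%N -> (f i <= f j)%N.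
Proof.
by move: (valP f) => /forallP/(_ i)/forallP/(_ j)/implyP.
Qed.

Lemma ordmapP m n (f g : ordmap m n) : f =1 g -> f = g.
Proof. by move=> fg; apply/val_inj/ffunP. Qed.

Lemma mk_ordmap_subproof m n (f : 'I_m.+1 -> 'I_n.+1) :
  {homo f : i j / (i <= j)%N} ->
  [forall i : 'I_m.+1, forall j : 'I_m.+1,
    (i <= j)%N ==> ([ffun x => f x] i <= [ffun x => f x] j)%N].
Proof.
by move=> fh; apply/forallP=> i; apply/forallP=> j; apply/implyP; rewrite !ffunE => /fh.
Qed.

Definition mk_ordmap m n (f : 'I_m.+1 -> 'I_n.+1)
    (fh : {homo f : i j / (i <= j)%N}) : ordmap m n :=
  OrdMap (mk_ordmap_subproof fh).

Lemma mk_ordmapE m n f fh x : @mk_ordmap m n f fh x = f x.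
Proof. exact: ffunE. Qed.

Definition oid n : ordmap n n :=
  @mk_ordmap n n (fun x => x) (fun _ _ h => h).

Definition ocomp l m n (g : ordmap m n) (f : ordmap l m) : ordmap l n :=
  @mk_ordmap l n (fun x => g (f x))
    (fun i j h => ordmap_homo g (ordmap_homo f h)).

Definition oconst m n (v : 'I_n.+1) : ordmap m n :=
  @mk_ordmap m n (fun=> v) (fun _ _ _ => leqnn v).

Lemma oidE n x : oid n x = x. Proof. exact: mk_ordmapE. Qed.
Lemma ocompE l m n (g : ordmap m n) (f : ordmap l m) x : ocomp g f x = g (f x).
Proof. exact: mk_ordmapE. Qed.
Lemma oconstE m n v x : oconst m v x = v :> 'I_n.+1.
Proof. exact: mk_ordmapE. Qed.

Lemma ocompA k l m n (h : ordmap m n) (g : ordmap l m) (f : ordmap k l) :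
  ocomp h (ocomp g f) = ocomp (ocomp h g) f.
Proof. by apply/ordmapP=> x; rewrite !ocompE. Qed.
Lemma ocompf1 m n (f : ordmap m n) : ocomp f (oid m) = f.
Proof. by apply/ordmapP=> x; rewrite ocompE oidE. Qed.
Lemma ocomp_const l m n (f : ordmap l m) (v : 'I_n.+1) :
  ocomp (oconst m v) f = oconst l v.
Proof. by apply/ordmapP=> x; rewrite ocompE !oconstE. Qed.

Record sset := SSet {
  simplex :> nat -> Type;
  sact : forall m n, ordmap m n -> simplex n -> simplex m;
  sact_id : forall n (x : simplex n), sact (oid n) x = x;
  sact_comp : forall l m n (g : ordmap m n) (f : ordmap l m) (x : simplex n),
    sact (ocomp g f) x = sact f (sact g x) }.

Record smap (X Y : sset) := SMap {
  smap_fun : forall n, X n -> Y n;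
  smap_nat : forall m n (f : ordmap m n) (x : X n),
    smap_fun (sact f x) = sact f (smap_fun x) }.

Definition sset_iso (X Y : sset) : Prop :=
  exists h : smap X Y, forall n, bijective (@smap_fun X Y h n).

Definition Delta (n : nat) : sset :=
  @SSet (fun k => ordmap k n) (fun _ _ f s => ocomp s f)
    (fun _ s => ocompf1 s) (fun _ _ _ g f s => ocompA s g f).

Record cylinder := Cylinder {
  cyl_total :> sset;
  cyl_map : smap cyl_total (Delta 1) }.

Section Preimage.
Variables (K : cylinder) (v : 'I_2).

(* The preimage of the vertex v of Delta[1]: [oconst k v] is the k-simplex of
   Delta[1] that is totally degenerate at v. *)
Definition vertex_fiber (k : nat) : Type :=
  {x : K k | smap_fun (cyl_map K) x == oconst k v}.

Lemma vertex_fiber_act_subproof m n (f : ordmap m n) (x : vertex_fiber n) :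
  smap_fun (cyl_map K) (sact f (sval x)) == oconst m v.
Proof. by rewrite smap_nat (eqP (svalP x)) /= ocomp_const. Qed.

Definition vertex_fiber_act m n (f : ordmap m n) (x : vertex_fiber n) :
  vertex_fiber m := exist _ (sact f (sval x)) (vertex_fiber_act_subproof f x).

Lemma vertex_fiber_act_id n x : vertex_fiber_act (oid n) x = x.
Proof. by apply: val_inj; rewrite /= sact_id. Qed.

Lemma vertex_fiber_act_comp l m n (g : ordmap m n) (f : ordmap l m) x :
  vertex_fiber_act (ocomp g f) x = vertex_fiber_act f (vertex_fiber_act g x).
Proof. by apply: val_inj; rewrite /= sact_comp. Qed.

Definition vertex_preimage : sset :=
  SSet vertex_fiber_act_id vertex_fiber_act_comp.
End Preimage.

Definition cobase (K : cylinder) : sset := vertex_preimage K ord0.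
Definition base (K : cylinder) : sset := vertex_preimage K ord_max.

Definition projective_cone (K : cylinder) (B : sset) : Prop :=
  sset_iso (base K) B /\ sset_iso (cobase K) (Delta 0).

(* A morphism t -> s of simplices of Delta[1] is a map f with s o f = t. *)
Record presheaf1 := Presheaf1 {
  psec :> forall k, ordmap k 1 -> Type;
  pact : forall m n (s : ordmap n 1) (t : ordmap m 1) (f : ordmap m n),
    ocomp s f = t -> psec s -> psec t;
  pact_id : forall n (s : ordmap n 1) (e : ocomp s (oid n) = s) (x : psec s),
    pact e x = x;
  pact_comp : forall l m n (s : ordmap n 1) (t : ordmap m 1) (u : ordmap l 1)
    (g : ordmap m n) (f : ordmap l m) (eg : ocomp s g = t) (ef : ocomp t f = u)
    (egf : ocomp s (ocomp g f) = u) (x : psec s),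
    pact egf x = pact ef (pact eg x) }.

Section CylinderOfPresheaf.
Variable F : presheaf1.

Definition pcyl_simplex (k : nat) : Type := {s : ordmap k 1 & F k s}.

Definition pcyl_act m n (f : ordmap m n) (x : pcyl_simplex n) : pcyl_simplex m :=
  existT _ (ocomp (projT1 x) f) (pact (erefl _) (projT2 x)).

Lemma pcyl_actE m n (f : ordmap m n) s t (e : ocomp s f = t) (x : F n s) :
  pcyl_act f (existT _ s x) = existT _ t (pact e x).
Proof. by case: t / e. Qed.

Lemma pcyl_act_id n x : pcyl_act (oid n) x = x.
Proof. by case: x => s x; rewrite (pcyl_actE (ocompf1 s)) pact_id. Qed.

Lemma pcyl_act_comp l m n (g : ordmap m n) (f : ordmap l m) x :
  pcyl_act (ocomp g f) x = pcyl_act f (pcyl_act g x).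
Proof.
case: x => s x; rewrite (pcyl_actE (ocompA s g f)).
by rewrite (pact_comp (erefl (ocomp s g)) (erefl (ocomp (ocomp s g) f))).
Qed.

Definition pcyl_total : sset := SSet pcyl_act_id pcyl_act_comp.

Definition cylinder_of_presheaf : cylinder :=
  @Cylinder pcyl_total
    (@SMap pcyl_total (Delta 1) (fun _ x => projT1 x) (fun _ _ _ _ => erefl)).
End CylinderOfPresheaf.

(* A non-degenerate simplex of Delta[m] is a non-empty set F of vertices, and a
   normalized cochain c has coordinate c F on the basis element 1_F.  The empty
   set is not a face: cochains are required below to vanish on it. *)
Section Cochains.
Variable R : comNzRingType.

(* the position of x in F, i.e. the i such that F :\ x is the i-th face of F *)
Definition pos m (x : 'I_m.+1) (F : {set 'I_m.+1}) : nat :=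
  #|[set y in F | (y < x)%N]|.

Definition coboundary m (c : {set 'I_m.+1} -> R) (F : {set 'I_m.+1}) : R :=
  \sum_(x in F) (-1) ^+ pos x F * c (F :\ x).

(* The image of F under f is a degenerate simplex unless f is injective on F. *)
Definition restrict m n (f : ordmap m n) (c : {set 'I_n.+1} -> R)
    (F : {set 'I_m.+1}) : R :=
  if #|f @: F| == #|F| then c (f @: F) else 0.

Lemma eq_coboundary m (c d : {set 'I_m.+1} -> R) F :
  c =1 d -> coboundary c F = coboundary d F.
Proof. by move=> cd; apply: eq_bigr => x _; rewrite cd. Qed.

Lemma eq_restrict m n (f : ordmap m n) (c d : {set 'I_n.+1} -> R) F :
  c =1 d -> restrict f c F = restrict f d F.
Proof. by move=> cd; rewrite /restrict cd. Qed.

Lemma coboundary0 m (F : {set 'I_m.+1}) : coboundary (fun=> 0) F = 0.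
Proof. by rewrite /coboundary big1 // => x _; rewrite mulr0. Qed.

Lemma restrict0 m n (f : ordmap m n) F : restrict f (fun=> 0) F = 0.
Proof. by rewrite /restrict if_same. Qed.

Lemma imset_oid n (F : {set 'I_n.+1}) : oid n @: F = F.
Proof. by rewrite (eq_imset _ (@oidE n)) imset_id. Qed.

Lemma imset_ocomp l m n (g : ordmap m n) (f : ordmap l m)
    (F : {set 'I_l.+1}) :
  ocomp g f @: F = g @: (f @: F).
Proof. by rewrite -imset_comp; apply: eq_imset => x; rewrite /= ocompE. Qed.

Lemma restrict_id n (c : {set 'I_n.+1} -> R) F : restrict (oid n) c F = c F.
Proof. by rewrite /restrict imset_oid eqxx. Qed.

Lemma card_imset_ocomp l m n (g : ordmap m n) (f : ordmap l m)
    (F : {set 'I_l.+1}) :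
  (#|ocomp g f @: F| == #|F|) =
  (#|f @: F| == #|F|) && (#|g @: (f @: F)| == #|f @: F|).
Proof.
rewrite imset_ocomp; have := leq_imset_card f (mem F).
have := leq_imset_card g (mem (f @: F)) => le1 le2.
case: eqP => [e|ne].
  have e2 : #|f @: F| = #|F| by apply/eqP; rewrite eqn_leq le2 -e le1.
  by rewrite e2 e !eqxx.
by apply/esym/negbTE/negP => /andP[/eqP e1 /eqP e2]; apply: ne; rewrite e2.
Qed.

Lemma restrict_comp l m n (g : ordmap m n) (f : ordmap l m)
    (c : {set 'I_n.+1} -> R) F :
  restrict (ocomp g f) c F = restrict f (restrict g c) F.
Proof.
rewrite /restrict card_imset_ocomp imset_ocomp.
by case: (_ == #|F|).
Qed.

Lemma coboundary_restrict m n (f : ordmap m n) (c : {set 'I_n.+1} -> R) F :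
  coboundary (restrict f c) F = restrict f (coboundary c) F.
Proof.
rewrite [RHS]/restrict; case: imset_injP => [finj|nfinj].
  rewrite /coboundary big_imset //=; apply: eq_bigr => x xF.
  have eqD : f @: (F :\ x) = (f @: F) :\ f x.
    apply/setP=> y; rewrite !inE; apply/imsetP/andP.
      case=> z; rewrite !inE => /andP[zx zF] ->; split; last exact: imset_f.
      by apply: contraNneq zx => /(finj _ _ zF xF) ->.
    case=> yx /imsetP[z zF yz]; exists z => //; rewrite !inE zF andbT.
    by apply: contraNneq yx => <-; rewrite yz.
  rewrite /restrict; case: imset_injP => [_|[]]; last first.
    by move=> y z /setD1P[_ yF] /setD1P[_ zF]; apply: finj.
  rewrite eqD; congr (_ ^+ _ * _); rewrite /pos.
  have -> : [set y in f @: F | (y < f x)%N] = f @: [set y in F | (y < x)%N].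
    apply/setP=> y; rewrite inE; apply/andP/imsetP.
      case=> /imsetP[z zF ->] lt; exists z => //; rewrite inE zF /=.
      by rewrite ltnNge; apply: contraL lt => /(ordmap_homo f); rewrite -leqNgt.
    case=> z; rewrite inE => /andP[zF zx] ->; split; first exact: imset_f.
    rewrite ltn_neqAle (ordmap_homo f (ltnW zx)) andbT.
    apply/negP => /eqP/val_inj/(finj _ _ zF xF) zxE.
    by rewrite zxE ltnn in zx.
  rewrite card_in_imset // => y z; rewrite !inE => /andP[yF _] /andP[zF _].
  exact: finj.
have [x [y [xF yF fxy xy]]] :
    exists x, exists y, [/\ x \in F, y \in F, f x = f y & (x < y)%N].
  have : ~~ dinjectiveb f F by apply/negP => /dinjectiveP.
  case/dinjectivePn => x xF [y yxF] fxy; case/andP: yxF => yx yF.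
  case: (ltngtP x y) => [lt|gt|/val_inj xyE].
  - by exists x, y.
  - by exists y, x.
  - by rewrite xyE eqxx in yx.
have xny : y != x by apply: contraTneq xy => ->; rewrite ltnn.
rewrite /coboundary (bigD1 x) //= (bigD1 y) /=; last by rewrite yF.
rewrite big1 ?addr0; last first.
  move=> z /andP[/andP[zF zx] zy]; rewrite /restrict.
  case: imset_injP => [inj|]; last by rewrite mulr0.
  have xFz : x \in F :\ z by rewrite !inE xF eq_sym zx.
  have yFz : y \in F :\ z by rewrite !inE yF eq_sym zy.
  by rewrite (inj _ _ xFz yFz fxy) eqxx in xny.
have eqim : f @: (F :\ x) = f @: (F :\ y).
  apply/setP=> t; apply/imsetP/imsetP => -[z]; rewrite !inE => /andP[zx zF] ->.
    case: (eqVneq z y) => [->|zy]; last by exists z; rewrite // !inE zy.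
    by exists x; rewrite // !inE xF eq_sym xny.
  case: (eqVneq z x) => [->|zy]; last by exists z; rewrite // !inE zy.
  by exists y; rewrite // !inE yF xny.
have eqcard : #|F :\ x| = #|F :\ y|.
  by have := cardsD1 x F; have := cardsD1 y F; rewrite xF yF => -> [].
rewrite /restrict eqim eqcard.
case: imset_injP => [inj|]; last by rewrite !mulr0 addr0.
suff -> : pos y F = (pos x F).+1 by rewrite exprS mulN1r mulNr addrN.
rewrite /pos.
have -> : [set z in F | (z < y)%N] = x |: [set z in F | (z < x)%N].
  apply/setP=> z; rewrite !inE; case: (eqVneq z x) => [->|zx] /=.
    by rewrite xF xy.
  case zF: (z \in F) => //=; apply/idP/idP => [zy|/ltn_trans]; last exact.
  rewrite ltn_neqAle val_eqE zx /= leqNgt; apply/negP => xz.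
  have fzx : f z = f x.
    apply/val_inj/eqP; rewrite eqn_leq (ordmap_homo f (ltnW xz)) andbT.
    by rewrite fxy (ordmap_homo f (ltnW zy)).
  have zy' : z != y by apply: contraTneq zy => ->; rewrite ltnn.
  have zFy : z \in F :\ y by rewrite !inE zF zy'.
  have xFy : x \in F :\ y by rewrite !inE xF eq_sym xny.
  by rewrite (inj _ _ zFy xFy fzx) eqxx in zx.
by rewrite cardsU1 inE ltnn andbF.
Qed.

Definition cochain m := {ffun {set 'I_m.+1} -> R}.

Definition ncochain m (d : nat) (c : cochain m) : bool :=
  [forall F, (c F != 0) ==> (F != set0) && (#|F|.-1 == d)%N].

Definition dcochain m (c : cochain m) : cochain m :=
  [ffun F => coboundary c F].

Definition ncocycle m (d : nat) (c : cochain m) : bool :=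
  ncochain d c && (dcochain c == 0).

Definition cochain_act m n (f : ordmap m n) (c : cochain n) : cochain m :=
  [ffun F => restrict f c F].

Lemma ncocycle_act m n d (f : ordmap m n) (c : cochain n) :
  ncocycle d c -> ncocycle d (cochain_act f c).
Proof.
case/andP=> /forallP cd /eqP dc; apply/andP; split.
  apply/forallP=> F; rewrite ffunE /restrict.
  case: (#|f @: F| =P _) => [cF|]; last by rewrite eqxx.
  apply/implyP => /(implyP (cd _)); rewrite cF.
  by rewrite -!card_gt0 cF.
apply/eqP/ffunP=> F; rewrite !ffunE.
rewrite (@eq_coboundary _ _ (restrict f c)); last by move=> G; rewrite ffunE.
rewrite coboundary_restrict /restrict; case: ifP => // _.
by move/ffunP: dc => /(_ (f @: F)); rewrite !ffunE.
Qed.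

Definition EM_simplex (d k : nat) : Type := {c : cochain k | ncocycle d c}.

Definition EM_act d m n (f : ordmap m n) (c : EM_simplex d n) : EM_simplex d m :=
  exist _ (cochain_act f (sval c)) (ncocycle_act f (svalP c)).

Lemma EM_act_id d n (x : EM_simplex d n) : EM_act (oid n) x = x.
Proof. by apply/val_inj/ffunP=> F; rewrite /= ffunE restrict_id. Qed.

Lemma EM_act_comp d l m n (g : ordmap m n) (f : ordmap l m) (x : EM_simplex d n) :
  EM_act (ocomp g f) x = EM_act f (EM_act g x).
Proof.
apply/val_inj/ffunP=> F; rewrite /= !ffunE restrict_comp.
by apply: eq_restrict => G; rewrite ffunE.
Qed.

Definition EM (d : nat) : sset := SSet (@EM_act_id d) (@EM_act_comp d).

End Cochains.

(* A simplex Delta[a] * Delta[b] of Delta[1] is a map s : [k] -> [1]; Delta[a]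
   and Delta[b] are the faces of Delta[k] spanned by the vertices over 0 and
   over 1. *)
Definition verts k (s : ordmap k 1) (i : 'I_2) : {set 'I_k.+1} :=
  [set x | s x == i].

Definition regular k (s : ordmap k 1) : bool := verts s ord_max != set0.

(* c Delta[k] is Delta[k+1], with [ord_max] as its apex v, and c Delta[a] is its
   face spanned by [cone_verts s]. *)
Definition cone_verts k (s : ordmap k 1) : {set 'I_k.+2} :=
  ord_max |: [set lift ord_max x | x in verts s ord0].

Definition cone_fun m n (f : ordmap m n) (x : 'I_m.+2) : 'I_n.+2 :=
  if unlift ord_max x is Some y then lift ord_max (f y) else ord_max.

Lemma cone_fun_homo m n (f : ordmap m n) :
  {homo cone_fun f : i j / (i <= j)%N}.
Proof.
move=> i j; rewrite /cone_fun.
case: unliftP => [i' ->|->]; case: unliftP => [j' ->|->] // ij.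
- by move: ij; rewrite !lift_max; apply: ordmap_homo.
- by rewrite lift_max /= ltnW.
- by move: ij; rewrite lift_max /= leqNgt ltn_ord.
Qed.

Definition ocone m n (f : ordmap m n) : ordmap m.+1 n.+1 :=
  mk_ordmap (@cone_fun_homo m n f).

Lemma ocone_lift m n (f : ordmap m n) x :
  ocone f (lift ord_max x) = lift ord_max (f x).
Proof. by rewrite mk_ordmapE /cone_fun liftK. Qed.

Lemma ocone_max m n (f : ordmap m n) : ocone f ord_max = ord_max.
Proof. by rewrite mk_ordmapE /cone_fun unlift_none. Qed.

Lemma ocone_id n : ocone (oid n) = oid n.+1.
Proof.
apply/ordmapP=> x; rewrite oidE.
by case: (unliftP ord_max x) => [y|] ->; rewrite ?ocone_lift ?ocone_max ?oidE.
Qed.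

Lemma ocone_comp l m n (g : ordmap m n) (f : ordmap l m) :
  ocone (ocomp g f) = ocomp (ocone g) (ocone f).
Proof.
apply/ordmapP=> x; rewrite ocompE.
by case: (unliftP ord_max x) => [y|] ->; rewrite ?ocone_lift ?ocone_max ?ocompE.
Qed.

Lemma ocone_eq_max m n (f : ordmap m n) x :
  (ocone f x == ord_max) = (x == ord_max).
Proof.
case: (unliftP ord_max x) => [y|] ->; last by rewrite ocone_max !eqxx.
by rewrite ocone_lift ![lift _ _ == _]eq_sym !(negPf (neq_lift _ _)).
Qed.

Lemma mem_ocone_max m n (f : ordmap m n) (E : {set 'I_m.+2}) :
  (ord_max \in ocone f @: E) = (ord_max \in E).
Proof.
apply/imsetP/idP => [[x xE /esym/eqP]|mE]; last first.
  by exists ord_max => //; rewrite ocone_max.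
by rewrite ocone_eq_max => /eqP <-.
Qed.

Lemma verts_comp m n (s : ordmap n 1) (f : ordmap m n) i x :
  (x \in verts (ocomp s f) i) = (f x \in verts s i).
Proof. by rewrite !inE ocompE. Qed.

Lemma mem_cone_verts k (s : ordmap k 1) x :
  (lift ord_max x \in cone_verts s) = (x \in verts s ord0).
Proof.
rewrite !inE eq_sym (negPf (neq_lift _ _)) /= mem_imset; last exact: lift_inj.
by rewrite inE.
Qed.

Lemma cone_verts_comp m n (s : ordmap n 1) (f : ordmap m n) x :
  (x \in cone_verts (ocomp s f)) = (ocone f x \in cone_verts s).
Proof.
case: (unliftP ord_max x) => [y|] ->; last by rewrite ocone_max !setU11.
by rewrite ocone_lift !mem_cone_verts verts_comp.
Qed.

(* (E, F) indexes the basis element 1_(F_0,epsilon) (x) 1_F1 with F_1 = F and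
   (F_0,epsilon) = E; epsilon is 1 if [ord_max] is in E, and 0 otherwise.  There
   is no basis element on a non-regular simplex. *)
Definition bcell k (s : ordmap k 1) (EF : {set 'I_k.+2} * {set 'I_k.+1}) : bool :=
  [&& regular s, EF.1 != set0, EF.1 \subset cone_verts s,
      EF.2 != set0 & EF.2 \subset verts s ord_max].

Lemma bcell_comp m n (s : ordmap n 1) (f : ordmap m n) E F :
  bcell (ocomp s f) (E, F) = bcell s (ocone f @: E, f @: F).
Proof.
rewrite /bcell /= !imset_eq0.
have -> : (ocone f @: E \subset cone_verts s) = (E \subset cone_verts (ocomp s f)).
  apply/subsetP/subsetP => [h x xE|h _ /imsetP[x xE ->]].
    by rewrite cone_verts_comp h // imset_f.
  by rewrite -cone_verts_comp h.
have -> : (f @: F \subset verts s ord_max) = (F \subset verts (ocomp s f) ord_max).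
  apply/subsetP/subsetP => [h x xF|h _ /imsetP[x xF ->]].
    by rewrite verts_comp h // imset_f.
  by rewrite -verts_comp h.
case: (boolP (F == set0)) => [_|F0] /=; first by rewrite !andbF.
case: (boolP (F \subset _)) => [/subsetP Fs|]; last by rewrite !andbF.
have /set0Pn[x xF] := F0.
have -> : regular (ocomp s f) by apply/set0Pn; exists x; apply: Fs.
by have -> : regular s by apply/set0Pn; exists (f x); rewrite -verts_comp Fs.
Qed.

(* The values are those on the vertices 0 and 1 of [1]. *)
Record perversity := Perversity {
  perv :> 'I_2 -> \bar int;
  perv_regular : perv ord_max = 0%E }.

Section BlownUp.
Variable R : comNzRingType.

Definition bcochain k := {ffun {set 'I_k.+2} * {set 'I_k.+1} -> R}.

Definition supported k (s : ordmap k 1) (w : bcochain k) : bool :=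
  [forall EF, (w EF != 0) ==> bcell s EF].

Definition bdegree k (EF : {set 'I_k.+2} * {set 'I_k.+1}) : nat :=
  (#|EF.1|.-1 + #|EF.2|.-1)%N.

Definition homogeneous k (d : nat) (w : bcochain k) : bool :=
  [forall EF, (w EF != 0) ==> (bdegree EF == d)].

(* the differential of a tensor product, with the Koszul sign *)
Definition bdiff k (s : ordmap k 1) (w : bcochain k) : bcochain k :=
  [ffun EF => if bcell s EF then
     coboundary (fun E => w (E, EF.2)) EF.1
     + (-1) ^+ #|EF.1|.-1 * coboundary (fun F => w (EF.1, F)) EF.2
   else 0].

Definition cell_pdeg k (EF : {set 'I_k.+2} * {set 'I_k.+1}) : \bar int :=
  if ord_max \in EF.1 then -oo%E else (Posz #|EF.2|.-1)%:E%E.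

Definition pdeg k (w : bcochain k) : \bar int :=
  \big[Order.max/-oo%E]_(EF | w EF != 0) cell_pdeg EF.

Definition perverse_cochain k (s : ordmap k 1) (p : perversity)
    (w : bcochain k) : bool :=
  [&& supported s w, (pdeg w <= p ord0)%E & (pdeg (bdiff s w) <= p ord0)%E].

Definition perverse_cocycle k (s : ordmap k 1) (d : nat) (p : perversity)
    (w : bcochain k) : bool :=
  [&& perverse_cochain s p w, homogeneous d w & bdiff s w == 0].

Definition bcochain_act m n (f : ordmap m n) (w : bcochain n) : bcochain m :=
  [ffun EF =>
     restrict (ocone f) (fun E => restrict f (fun F => w (E, F)) EF.2) EF.1].

Lemma bcochain_act_id n (w : bcochain n) : bcochain_act (oid n) w = w.
Proof. by apply/ffunP=> -[E F]; rewrite ffunE ocone_id !restrict_id. Qed.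

Lemma bcochain_act_comp l m n (g : ordmap m n) (f : ordmap l m) (w : bcochain n) :
  bcochain_act (ocomp g f) w = bcochain_act f (bcochain_act g w).
Proof.
apply/ffunP=> -[E F]; rewrite !ffunE ocone_comp restrict_comp /=.
apply: eq_restrict => E'; rewrite /restrict card_imset_ocomp.
case: (#|f @: F| == _) => /=; last by rewrite if_same.
by rewrite !ffunE /restrict imset_ocomp.
Qed.

Lemma bcochain_act_neq0 m n (f : ordmap m n) (w : bcochain n) E F :
  bcochain_act f w (E, F) != 0 ->
  [/\ w (ocone f @: E, f @: F) != 0, #|ocone f @: E| = #|E| & #|f @: F| = #|F|].
Proof.
rewrite ffunE /= /restrict.
case: (#|ocone f @: E| =P _) => [eE|]; last by rewrite eqxx.
by case: (#|f @: F| =P _) => [eF|]; last by rewrite eqxx.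
Qed.

Lemma supported_act m n (s : ordmap n 1) (f : ordmap m n) (w : bcochain n) :
  supported s w -> supported (ocomp s f) (bcochain_act f w).
Proof.
move=> /forallP sw; apply/forallP => -[E F]; apply/implyP.
by case/bcochain_act_neq0 => /(implyP (sw _)); rewrite bcell_comp.
Qed.

Lemma homogeneous_act m n d (f : ordmap m n) (w : bcochain n) :
  homogeneous d w -> homogeneous d (bcochain_act f w).
Proof.
move=> /forallP hw; apply/forallP => -[E F]; apply/implyP.
by case/bcochain_act_neq0 => /(implyP (hw _)); rewrite /bdegree /= => h eE eF; rewrite -eE -eF.
Qed.

Lemma bdiff_act m n (s : ordmap n 1) (f : ordmap m n) (w : bcochain n) :
  bdiff (ocomp s f) (bcochain_act f w) = bcochain_act f (bdiff s w).
Proof.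
apply/ffunP => -[E F]; rewrite [LHS]ffunE bcell_comp [RHS]ffunE /=.
have [eE|nE] := eqVneq #|ocone f @: E| #|E|; last first.
  rewrite [RHS]/restrict (negPf nE); case: ifP => // _.
  rewrite (@eq_coboundary _ _ _
    (restrict (ocone f) (fun E => restrict f (fun F => w (E, F)) F))); last first.
    by move=> E'; rewrite ffunE.
  rewrite coboundary_restrict /restrict (negPf nE) add0r.
  rewrite (@eq_coboundary _ _ _ (fun=> 0)) ?coboundary0 ?mulr0 // => F'.
  by rewrite ffunE /= /restrict (negPf nE).
have [eF|nF] := eqVneq #|f @: F| #|F|; last first.
  rewrite [RHS]/restrict eE eqxx [RHS]/restrict (negPf nF); case: ifP => // _.
  rewrite (@eq_coboundary _ _ _ (fun=> 0)) ?coboundary0 ?add0r; last first.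
    by move=> E'; rewrite ffunE /= {2}/restrict (negPf nF) restrict0.
  rewrite (@eq_coboundary _ _ _ (restrict f (fun F => w (ocone f @: E, F)))).
    by rewrite coboundary_restrict /restrict (negPf nF) mulr0.
  by move=> F'; rewrite ffunE /= {1}/restrict eE eqxx.
rewrite [RHS]/restrict eE eqxx [RHS]/restrict eF eqxx [RHS]ffunE.
case: ifP => //= _; rewrite -eE; congr (_ + _ * _).
  rewrite (@eq_coboundary _ _ _
    (restrict (ocone f) (fun E => restrict f (fun F => w (E, F)) F))); last first.
    by move=> E'; rewrite ffunE.
  rewrite coboundary_restrict /restrict eE eqxx.
  by apply: eq_coboundary => E'; rewrite eF eqxx.
rewrite (@eq_coboundary _ _ _ (restrict f (fun F => w (ocone f @: E, F)))).
  by rewrite coboundary_restrict /restrict eF eqxx.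
by move=> F'; rewrite ffunE /= {1}/restrict eE eqxx.
Qed.

Lemma pdeg_leP k (w : bcochain k) (q : \bar int) :
  reflect (forall EF, w EF != 0 -> (cell_pdeg EF <= q)%E) (pdeg w <= q)%E.
Proof.
by apply: (iffP (bigmax_leP _ _ _ _)) => [[] //|h]; split => //; rewrite leNye.
Qed.

Lemma pdeg_act m n (f : ordmap m n) (w : bcochain n) q :
  (pdeg w <= q)%E -> (pdeg (bcochain_act f w) <= q)%E.
Proof.
move=> /pdeg_leP wq; apply/pdeg_leP => -[E F].
by case/bcochain_act_neq0 => /wq; rewrite /cell_pdeg /= mem_ocone_max => h _ <-.
Qed.

Lemma perverse_cocycle_act m n (s : ordmap n 1) (f : ordmap m n) d p w :
  perverse_cocycle s d p w -> perverse_cocycle (ocomp s f) d p (bcochain_act f w).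
Proof.
case/and3P=> /and3P[sw wp dwp] hw /eqP dw0.
rewrite /perverse_cocycle /perverse_cochain bdiff_act.
rewrite supported_act // !pdeg_act // homogeneous_act //= dw0.
by apply/eqP/ffunP=> EF; rewrite !ffunE /restrict !ffunE !if_same.
Qed.

Variables (d : nat) (p : perversity).

Definition PEM_sec k (s : ordmap k 1) : Type :=
  {w : bcochain k | perverse_cocycle s d p w}.

Lemma PEM_act_subproof m n (s : ordmap n 1) (t : ordmap m 1) (f : ordmap m n)
    (e : ocomp s f = t) (x : PEM_sec s) :
  perverse_cocycle t d p (bcochain_act f (sval x)).
Proof. by case: t / e; apply: perverse_cocycle_act (svalP x). Qed.

Definition PEM_act m n (s : ordmap n 1) (t : ordmap m 1) (f : ordmap m n)
    (e : ocomp s f = t) (x : PEM_sec s) : PEM_sec t :=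
  exist _ (bcochain_act f (sval x)) (PEM_act_subproof e x).

Lemma PEM_act_id n (s : ordmap n 1) (e : ocomp s (oid n) = s) x : PEM_act e x = x.
Proof. by apply: val_inj; rewrite /= bcochain_act_id. Qed.

Lemma PEM_act_comp l m n (s : ordmap n 1) (t : ordmap m 1) (u : ordmap l 1)
    (g : ordmap m n) (f : ordmap l m) (eg : ocomp s g = t) (ef : ocomp t f = u)
    (egf : ocomp s (ocomp g f) = u) (x : PEM_sec s) :
  PEM_act egf x = PEM_act ef (PEM_act eg x).
Proof. by apply: val_inj; rewrite /= bcochain_act_comp. Qed.

Definition PEM_presheaf : presheaf1 := Presheaf1 PEM_act_id PEM_act_comp.

Definition PEM : cylinder := cylinder_of_presheaf PEM_presheaf.

End BlownUp.

(* Main.v *)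
Require Import Defs.
From mathcomp Require Import all_boot all_order all_algebra.
From mathcomp Require Import constructive_ereal.

(** Over the vertex 1 the complex is [N^*({v}) (x) N^*(Delta[b])], on which the
    perversity condition is void because every cell contains the apex [v]; so a
    section is the same as a cochain [F |-> w ({v}, F)].  Over the vertex 0 no
    simplex is regular and the only section is 0. *)

Set Implicit Arguments.
Unset Strict Implicit.
Unset Printing Implicit Defensive.

Import Order.TTheory GRing.Theory Num.Theory.
Local Open Scope ring_scope.

Lemma verts_oconst k (v i : 'I_2) :
  verts (oconst k v) i = if v == i then setT else set0.
Proof. by apply/setP=> x; rewrite inE oconstE; case: ifP; rewrite inE. Qed.

Lemma bcell_oconst0 k EF : bcell (oconst k ord0) EF = false.
Proof. by rewrite /bcell /regular verts_oconst /= eqxx. Qed.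

(** With no vertex over 0, [cone_verts] shrinks to the apex, so a non-empty [E] must be [{v}].
    Regularity is automatic because [[k]] has at least one vertex. *)
Lemma bcell_oconst1 k (E : {set 'I_k.+2}) (F : {set 'I_k.+1}) :
  bcell (oconst k ord_max) (E, F) = (E == [set ord_max]) && (F != set0).
Proof.
have -> : bcell (oconst k ord_max) (E, F)
    = [&& E != set0, E \subset [set ord_max] & F != set0].
  rewrite /bcell /regular /cone_verts !verts_oconst eqxx /= imset0 setU0 subsetT.
  by rewrite andbT -card_gt0 cardsT card_ord.
rewrite subset1; case: (eqVneq E [set ord_max]) => [->|_].
  by rewrite orTb -card_gt0 cards1.
by case: (E =P set0).
Qed.

Section Apex.
Variables (R : comNzRingType) (k : nat).
Implicit Types (w : bcochain R k) (c : cochain R k).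
Local Notation s1 := (oconst k (@ord_max 1)).

Definition apex_slice w : cochain R k := [ffun F => w ([set ord_max], F)].

Definition apex_extend c : bcochain R k :=
  [ffun EF => if EF.1 == [set ord_max] then c EF.2 else 0].

Lemma supported_neq0 (s : ordmap k 1) w EF :
  supported s w -> w EF != 0 -> bcell s EF.
Proof. by move/forallP/(_ EF)/implyP. Qed.

Lemma supported_notcell (s : ordmap k 1) w EF :
  supported s w -> ~~ bcell s EF -> w EF = 0.
Proof. by move=> sw; apply: contraNeq; apply: supported_neq0 sw. Qed.

Lemma apex_extendK : cancel apex_extend apex_slice.
Proof. by move=> c; apply/ffunP=> F; rewrite !ffunE eqxx. Qed.

Lemma apex_sliceK w : supported s1 w -> apex_extend (apex_slice w) = w.
Proof.
move=> sw; apply/ffunP=> -[E F]; rewrite ffunE /=.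
case: eqP => [->|/eqP nE]; first by rewrite ffunE.
by rewrite (supported_notcell sw) // bcell_oconst1 (negPf nE).
Qed.

Lemma bdiff_apex w (F : {set 'I_k.+1}) : supported s1 w ->
  bdiff s1 w ([set ord_max], F) = dcochain (apex_slice w) F.
Proof.
move=> sw; rewrite !ffunE bcell_oconst1 eqxx /=.
(* At [F = set0] the left side is the default 0 off the cells and the right side is an empty sum. *)
case: (eqVneq F set0) => [->|_] /=; first by rewrite /coboundary big_set0.
(* The point [{v}] has dimension 0, so the Koszul sign is 1. Its only face is empty, and [w]
   vanishes there by support. *)
rewrite cards1 expr0 mul1r {1}/coboundary big_set1 setDv.
rewrite (supported_notcell sw) ?mulr0 ?add0r; last first.
  by rewrite /bcell /= eqxx andbF.
by apply: eq_coboundary => G; rewrite ffunE.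
Qed.

Lemma bdiff_apex_eq0 w : supported s1 w ->
  (bdiff s1 w == 0) = (dcochain (apex_slice w) == 0).
Proof.
move=> sw; apply/eqP/eqP=> d0; apply/ffunP=> X.
  by rewrite -bdiff_apex // d0 !ffunE.
case: X => E F; rewrite [RHS]ffunE.
case: (eqVneq E [set ord_max]) => [->|nE]; first by rewrite bdiff_apex // d0 ffunE.
by rewrite ffunE bcell_oconst1 (negPf nE).
Qed.

(** The pointwise hypothesis suits both a supported cochain and its differential, the latter through
    [bdiff_neq0]. *)
Lemma pdeg_apex w p : (forall EF, w EF != 0 -> bcell s1 EF) -> (pdeg w <= p)%E.
Proof.
move=> sw; apply/pdeg_leP => -[E F] /sw; rewrite bcell_oconst1 => /andP[/eqP -> _].
by rewrite /cell_pdeg /= set11 leNye.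
Qed.

Lemma bdiff_neq0 (s : ordmap k 1) w EF : bdiff s w EF != 0 -> bcell s EF.
Proof. by rewrite ffunE; case: ifP; rewrite ?eqxx. Qed.

Lemma ncocycle_apex_slice d p w :
  perverse_cocycle s1 d p w -> ncocycle d (apex_slice w).
Proof.
case/and3P=> /and3P[sw _ _] /forallP hw dw.
rewrite /ncocycle -bdiff_apex_eq0 // dw andbT.
apply/forallP=> F; rewrite ffunE; apply/implyP=> wF.
have := supported_neq0 sw wF; rewrite bcell_oconst1 => /andP[_ ->].
by have /implyP/(_ wF) := hw ([set ord_max], F); rewrite /bdegree /= cards1.
Qed.

Lemma perverse_apex_extend d p c :
  ncocycle d c -> perverse_cocycle s1 d p (apex_extend c).
Proof.
case/andP=> /forallP hc dc.
(* Normalized cochains vanish on the empty set, which is what keeps the extension on cells. *)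
have sw : supported s1 (apex_extend c).
  apply/forallP=> -[E F]; rewrite ffunE bcell_oconst1 /=.
  case: (E == [set ord_max]) => /=; last by rewrite eqxx.
  by apply/implyP=> /(implyP (hc F))/andP[].
apply/and3P; split.
- rewrite /perverse_cochain sw !pdeg_apex // => EF; last exact: (supported_neq0 sw).
  exact: bdiff_neq0.
- apply/forallP=> -[E F]; rewrite ffunE /bdegree /=.
  case: (E =P [set ord_max]) => [->|_]; last by rewrite eqxx.
  by rewrite cards1; apply/implyP=> /(implyP (hc F))/andP[].
- by rewrite bdiff_apex_eq0 // apex_extendK.
Qed.

End Apex.

(** [ocone f] fixes the apex, so the first restriction is never degenerate on [{v}] and only the
    second factor is affected. *)
Lemma apex_slice_act (R : comNzRingType) m n (f : ordmap m n) (w : bcochain R n) :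
  apex_slice (bcochain_act f w) = cochain_act f (apex_slice w).
Proof.
apply/ffunP=> F; rewrite !ffunE /= [LHS]/restrict imset_set1 ocone_max !cards1 eqxx.
by apply: eq_restrict => G; rewrite ffunE.
Qed.

Section Iso.
Variables (R : comNzRingType) (d : nat) (p : perversity).
Local Notation K := (PEM R d p).

Definition base_cochain k (x : base K k) : cochain R k :=
  apex_slice (sval (projT2 (sval x))).

Lemma ncocycle_base k (x : base K k) : ncocycle d (base_cochain x).
Proof.
(* Substituting the fibre equation for [s] turns the dependent pair into a section over the constant
   simplex, with no transport left. *)
case: x => -[s [w pw]] /= es; have e := eqP es; rewrite /= in e; subst s.
by apply: ncocycle_apex_slice pw.
Qed.

Definition base_to_EM k (x : base K k) : EM R d k :=
  exist _ (base_cochain x) (ncocycle_base x).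

Lemma base_to_EM_nat m n (f : ordmap m n) (x : base K n) :
  base_to_EM (sact f x) = sact f (base_to_EM x).
Proof. by apply: val_inj; apply: apex_slice_act. Qed.

Definition EM_to_base k (c : EM R d k) : base K k :=
  exist (fun x : K k => smap_fun (cyl_map K) x == oconst k ord_max)
    (existT (fun s => PEM_sec R d p s) (oconst k ord_max)
      (exist _ (apex_extend (sval c)) (perverse_apex_extend p (svalP c))))
    (eqxx _).

Lemma base_iso : sset_iso (base K) (EM R d).
Proof.
exists (@SMap (base K) (EM R d) base_to_EM base_to_EM_nat) => k.
exists (@EM_to_base k) => [[[s [w pw]] /= es]|c]; last first.
  by apply: val_inj; apply: apex_extendK.
have e := eqP es; rewrite /= in e; subst s.
apply: val_inj; congr existT; apply: val_inj; apply: apex_sliceK.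
by case/and3P: (pw) => /and3P[].
Qed.

(** There are no cells here, so support forces [w = 0]. Conversely 0 qualifies for every perversity,
    even [-oo], since its perverse degree is an empty maximum. *)
Lemma perverse_cocycle_oconst0 k (w : bcochain R k) :
  perverse_cocycle (oconst k ord0) d p w = (w == 0).
Proof.
apply/idP/eqP => [/and3P[/and3P[sw _ _] _ _]|->].
  by apply/ffunP=> EF; rewrite (supported_notcell sw) ?ffunE ?bcell_oconst0.
have d0 : bdiff (oconst k ord0) (0 : bcochain R k) = 0.
  by apply/ffunP=> EF; rewrite ffunE bcell_oconst0 ffunE.
have deg0 : (pdeg (0%R : bcochain R k) <= p ord0)%E.
  by apply/pdeg_leP=> EF; rewrite ffunE eqxx.
rewrite /perverse_cocycle /perverse_cochain d0 deg0 eqxx !andbT.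
by apply/andP; split; apply/forallP=> EF; rewrite ffunE eqxx.
Qed.

Lemma zero_perverse_cocycle k : perverse_cocycle (oconst k ord0) d p (0 : bcochain R k).
Proof. by rewrite perverse_cocycle_oconst0. Qed.

Definition cobase_point k : cobase K k :=
  exist (fun x : K k => smap_fun (cyl_map K) x == oconst k ord0)
    (existT (fun s => PEM_sec R d p s) (oconst k ord0)
      (exist _ 0 (zero_perverse_cocycle k)))
    (eqxx _).

Lemma cobase_pointP k (x : cobase K k) : cobase_point k = x.
Proof.
case: x => -[s [w pw]] /= es; have e := eqP es; rewrite /= in e; subst s.
apply: val_inj; congr existT; apply: val_inj => /=.
by apply/esym/eqP; rewrite -perverse_cocycle_oconst0.
Qed.

Lemma ordmap0P k (f g : ordmap k 0) : f = g.
Proof. by apply/ordmapP=> x; rewrite (ord1 (f x)) (ord1 (g x)). Qed.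

Lemma cobase_iso : sset_iso (cobase K) (Delta 0).
Proof.
(* Naturality and one of the two cancellations hold because [Delta 0] has a single simplex in each
   degree. *)
exists (@SMap (cobase K) (Delta 0) (fun k _ => oconst k ord0)
  (fun _ _ _ _ => ordmap0P _ _)) => k.
by exists (fun=> cobase_point k) => x; [apply: cobase_pointP | apply: ordmap0P].
Qed.

End Iso.

Theorem proposition6p1 (R : idomainType) (hR : dedekind_domain R) (n : nat)
    (p : perversity) :
  projective_cone (PEM R n p) (EM R n).
Proof. by split; [apply: base_iso | apply: cobase_iso]. Qed.
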